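(* Let $\mu$ be a joint distribution of $(X,A,Y)$ with $X\in\mathcal{X}\subseteq\mathbb{R}^d$, $A\in\{0,1\}$, $Y\in\{0,1\}$. For any (measurable) hypothesis $h:\mathcal{X}\to\{0,1\}$, $$\big|\mathrm{Err}_{\mu_0}(h)-\mathrm{Err}_{\mu_1}(h)\big|\le (n_{\mu_0}+n_{\mu_1})+d_{\mathrm{TV}}(\mu_0(X),\mu_1(X))+\min\big\{\mathbb{E}_{\mu_0}[|h_0^*(X)-h_1^*(X)|],\ \mathbb{E}_{\mu_1}[|h_0^*(X)-h_1^*(X)|]\big\}.$$
   Context: For $a\in\{0,1\}$, $\mu_a$ is the conditional distribution of $\mu$ given $A=a$ (it is assumed $\Pr(A=a)>0$), and $\mu_a(X)$ is the marginal law of $X$ under $\mu_a$. $\mathrm{Err}_{\mu_a}(h)=\Pr_{\mu_a}(Y\neq h(X))$. $h_a^*:\mathcal{X}\to\{0,1\}$ is the Bayes optimal classifier on $\mu_a$: $h_a^*(x)=1$ if $\mathbb{E}[Y\mid X=x,A=a]\ge 1/2$ and $0$ otherwise (for a fixed version of the conditional expectation). The noise (Bayes error) of $\mu_a$ is $n_{\mu_a}=\Pr_{\mu_a}(Y\neq h_a^*(X))=\mathbb{E}_{\mu_a}[|Y-h_a^*(X)|]$. $d_{\mathrm{TV}}(P,Q)=\sup_E|P(E)-Q(E)|$ over measurable $E$. *)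

(* Defs.v *)
From HB Require Import structures.
From mathcomp Require Import all_boot all_order all_algebra.
From mathcomp Require Import all_classical all_reals all_analysis.
Set Implicit Arguments.
Unset Strict Implicit.
Unset Printing Implicit Defensive.
Import Order.TTheory GRing.Theory Num.Theory.
Local Open Scope classical_set_scope.
Local Open Scope ring_scope.
Local Open Scope ereal_scope.

(* Measurable types are pointed, so the type of elements of a subset S carries
   a witness x0 that S is nonempty. *)
Definition pointed_subset (T : choiceType) (S : set T) (x0 : S) : Type := S.

HB.instance Definition _ (T : choiceType) (S : set T) (x0 : S) :=
  Choice.on (pointed_subset x0).
HB.instance Definition _ (T : choiceType) (S : set T) (x0 : S) :=
  isPointed.Build (pointed_subset x0) x0.

Definition incl (T : choiceType) (S : set T) (x0 : S) (x : pointed_subset x0) :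
    T :=
  set_val x.

(* A subset S of R^n, not necessarily measurable, with the trace on S of the
   Borel sigma-algebra, which n.-tuple R carries as the product of the Borel
   sigma-algebra of R. *)
Definition subspace_of (R : realType) (n : nat) (S : set (n.-tuple R)) (x0 : S)
  := g_sigma_algebra_preimageType (@incl (n.-tuple R) S x0).

Section Conditioning.
Context d (T : measurableType d) (R : realType) (P : probability T R).

(* P (. | E), that is, B |-> P (B `&` E) / P E when P E > 0; mnormalize
   returns its second argument P when P E = 0. *)
Definition cond_prob (E : set T) (mE : measurable E) : probability T R :=
  mnormalize (mrestr P mE) P.

(* g is a version of v |-> E[U | V = v]. *)
Definition cond_expectation_version d' (T' : measurableType d')
    (U : T -> R) (V : T -> T') (g : T' -> R) : Prop :=
  [/\ measurable_fun [set: T'] g,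
      P.-integrable [set: T] (fun w => (g (V w))%:E) &
      forall B : set T', measurable B ->
        \int[P]_(w in V @^-1` B) (g (V w))%:E =
        \int[P]_(w in V @^-1` B) (U w)%:E].

End Conditioning.

Definition d_TV d (T : measurableType d) (R : realType)
    (P Q : set T -> \bar R) : \bar R :=
  ereal_sup [set `|P E - Q E| | E in measurable].

Section Classification.
Context d (T : measurableType d) (R : realType).

Definition featX (w : T * bool * bool) : T := w.1.1.
Definition attrA (w : T * bool * bool) : bool := w.1.2.
Definition labelY (w : T * bool * bool) : bool := w.2.

Lemma measurable_attrA : measurable_fun [set: T * bool * bool] attrA.
Proof. exact: (measurableT_comp measurable_snd measurable_fst). Qed.

Lemma measurable_group (a : bool) : measurable [set w | attrA w = a].
Proof.
by rewrite -[X in measurable X]setTI; exact: (measurable_attrA measurableT (Y := [set a])).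
Qed.

Definition group (mu : probability (T * bool * bool)%type R) (a : bool) :
    probability (T * bool * bool)%type R :=
  cond_prob mu (measurable_group a).

Definition marginalX (nu : probability (T * bool * bool)%type R) :
    set T -> \bar R :=
  pushforward nu featX.

Definition Err (nu : probability (T * bool * bool)%type R) (h : T -> bool) :
    \bar R :=
  nu [set w | labelY w <> h (featX w)].

(* (x, a) |-> E[Y | X = x, A = a] *)
Definition regression_version (mu : probability (T * bool * bool)%type R)
    (eta : T * bool -> R) : Prop :=
  cond_expectation_version mu (fun w => (labelY w)%:R)
    (fun w => (featX w, attrA w)) eta.

Definition bayes (eta : T * bool -> R) (a : bool) (x : T) : bool :=
  (2^-1 <= eta (x, a))%R.

Definition noise (mu : probability (T * bool * bool)%type R)
    (eta : T * bool -> R) (a : bool) : \bar R :=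
  Err (group mu a) (bayes eta a).

Definition bayes_disagreement (nu : probability (T * bool * bool)%type R)
    (eta : T * bool -> R) : \bar R :=
  'E_nu[fun w => `|(bayes eta false (featX w))%:R
                   - (bayes eta true (featX w))%:R|%R].

End Classification.

(* Main.v *)
Require Import Defs.
From mathcomp Require Import all_boot all_order all_algebra.
From mathcomp Require Import all_classical all_reals all_analysis.
From mathcomp Require Import measurable_realfun.
Import Order.TTheory GRing.Theory Num.Theory.
Local Open Scope classical_set_scope.
Local Open Scope ring_scope.
Local Open Scope ereal_scope.

(** Under a fixed law, [P (f <> g)] is a pseudometric on [{0,1}]-valued
    classifiers, and [Err] is the distance to the label [Y]. For any classifier
    [g], passing from [mu_0 (Y <> h)] to [mu_1 (Y <> h)] through
    [mu_0 (g <> h)] and [mu_1 (g <> h)] costs [Err_(mu_0) g + Err_(mu_1) g],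
    plus one change of law for an event in [X] alone, which is bounded by
    [d_TV]. With [g = h*_0] the error of [g] under [mu_1] exceeds the noise by at
    most [mu_1 (h*_0 <> h*_1)]; with [g = h*_1] the roles of [mu_0] and [mu_1]
    are exchanged, whence the minimum. *)

Set Implicit Arguments.
Unset Strict Implicit.

Lemma abse_distC (R : realDomainType) (x y : \bar R) : `|x - y| = `|y - x|.
Proof. by case: x => [r| |]; case: y => [s| |] //=; rewrite distrC. Qed.

Lemma lee_abse_dist (R : realDomainType) (x y z : \bar R) :
  x \is a fin_num -> y \is a fin_num -> z \is a fin_num ->
  `|x - z| <= `|x - y| + `|y - z|.
Proof.
case: x y z => [x| |] [y| |] [z| |] // _ _ _.
by rewrite -!EFinB !abse_EFin -EFinD lee_fin; exact: ler_distD.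
Qed.

(** Finiteness of [x] and [y] matters: [+oo - +oo] is [-oo], whose absolute value is [+oo]. The
    bound [e] may be [+oo]. *)
Lemma abse_dist_le (R : realDomainType) (x y e : \bar R) :
  x \is a fin_num -> y \is a fin_num -> x <= y + e -> y <= x + e ->
  `|x - y| <= e.
Proof.
case: x y e => [x| |] [y| |] [e| |] // _ _; last by move=> _ _; exact: leey.
rewrite -EFinB abse_EFin -!EFinD !lee_fin => xy yx.
by rewrite ler_distlC; apply/andP; split; rewrite ?lerBlDr.
Qed.

Section Disagreement.
Context d (T : measurableType d) (R : realType) (nu : probability T R).

Lemma measurable_disagree (f g : T -> bool) :
  measurable_fun [set: T] f -> measurable_fun [set: T] g ->
  measurable [set w | f w <> g w].
Proof.
move=> mf mg.
rewrite (_ : [set w | _] = (fun w => f w (+) g w) @^-1` [set true]); last first.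
  by apply/seteqP; split=> w /=; case: (f w); case: (g w).
rewrite -[X in measurable X]setTI.
have -> : (fun w => f w (+) g w) = (fun w => f w && ~~ g w || ~~ f w && g w).
  by apply/funext => w; case: (f w); case: (g w).
by apply: measurable_or => //; apply: measurable_and => //; exact: measurable_neg.
Qed.

(** Where [f] and [k] differ, [g] differs from at least one of them; the union bound concludes. *)
Lemma disagree_trans (f g k : T -> bool) :
  measurable_fun [set: T] f -> measurable_fun [set: T] g ->
  measurable_fun [set: T] k ->
  nu [set w | f w <> k w] <= nu [set w | f w <> g w] + nu [set w | g w <> k w].
Proof.
move=> mf mg mk.
have mfg := measurable_disagree mf mg; have mgk := measurable_disagree mg mk.
apply: le_trans (measureU2 _ mfg mgk).
apply: le_measure; rewrite ?inE; [exact: measurable_disagree|exact: measurableU|].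
by move=> w /=; case: (f w); case: (g w); case: (k w) => //; [right|left|left|right].
Qed.

(** Reverse triangle inequality: [disagree_trans] used twice, once through [g] and once through
    [f]. *)
Lemma disagree_dist (f g k : T -> bool) :
  measurable_fun [set: T] f -> measurable_fun [set: T] g ->
  measurable_fun [set: T] k ->
  `|nu [set w | f w <> k w] - nu [set w | g w <> k w]|
    <= nu [set w | f w <> g w].
Proof.
move=> mf mg mk.
have fin (f' g' : T -> bool) (mf' : measurable_fun [set: T] f')
    (mg' : measurable_fun [set: T] g') : nu [set w | f' w <> g' w] \is a fin_num.
  exact: fin_num_measure (measurable_disagree mf' mg').
have sym : [set w | g w <> f w] = [set w | f w <> g w].
  by apply/seteqP; split=> w; exact: nesym.
apply: abse_dist_le; rewrite ?fin// addeC; first exact: disagree_trans.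
by rewrite -sym; exact: disagree_trans.
Qed.

Lemma expectation_disagree (f g : T -> bool) :
  measurable_fun [set: T] f -> measurable_fun [set: T] g ->
  'E_nu[fun w => `|(f w)%:R - (g w)%:R|%R] = nu [set w | f w <> g w].
Proof.
move=> mf mg.
have mfg := measurable_disagree mf mg.
(* For 0/1 values, the absolute difference is the indicator of disagreement. *)
rewrite unlock -[X in _ = nu X]setIT -integral_indic //; apply: eq_integral => w _.
rewrite indicE; congr (_ %:E).
have -> : (w \in [set w | f w <> g w]) = (f w != g w).
  by apply/idP/idP; [rewrite inE => fg; apply/eqP|move=> /eqP fg; rewrite inE].
by case: (f w); case: (g w); rewrite /= ?subrr ?subr0 ?sub0r ?normrN ?normr0 ?normr1.
Qed.

End Disagreement.

Section Classification.
Context d (T : measurableType d) (R : realType).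

Lemma measurable_featX : measurable_fun [set: T * bool * bool] (@featX _ T).
Proof. exact: (measurableT_comp measurable_fst measurable_fst). Qed.

Lemma measurable_labelY : measurable_fun [set: T * bool * bool] (@labelY _ T).
Proof. exact: measurable_snd. Qed.

Lemma measurable_bayes (eta : T * bool -> R) (a : bool) :
  measurable_fun [set: T * bool] eta ->
  measurable_fun [set: T] (bayes eta a).
Proof.
move=> meta; apply: measurable_fun_ler => //.
by apply: measurableT_comp => //; exact: pair2_measurable.
Qed.

(** The event is the preimage under [featX] of a measurable set of features, hence one of the events
    in the supremum. *)
Lemma disagree_d_TV (nu nu' : probability (T * bool * bool)%type R)
    (f g : T -> bool) :
  measurable_fun [set: T] f -> measurable_fun [set: T] g ->
  `|nu [set w | f (featX w) <> g (featX w)]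
    - nu' [set w | f (featX w) <> g (featX w)]|
    <= d_TV (marginalX nu) (marginalX nu').
Proof.
move=> mf mg; apply: ereal_sup_ubound.
by exists [set x | f x <> g x] => //; exact: measurable_disagree.
Qed.

Lemma measurable_on_featX (k : T -> bool) :
  measurable_fun [set: T] k ->
  measurable_fun [set: T * bool * bool] (fun w => k (featX w)).
Proof. by move=> mk; exact: measurableT_comp mk measurable_featX. Qed.

Lemma Err_dist (nu nu' : probability (T * bool * bool)%type R)
    (g h : T -> bool) :
  measurable_fun [set: T] g -> measurable_fun [set: T] h ->
  `|Err nu h - Err nu' h| <=
    Err nu g + Err nu' g + d_TV (marginalX nu) (marginalX nu').
Proof.
move=> mg mh.
have [mgX mhX] := (measurable_on_featX mg, measurable_on_featX mh).
pose D (m : probability (T * bool * bool)%type R) :=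
  m [set w | g (featX w) <> h (featX w)].
have finD m : D m \is a fin_num.
  exact: fin_num_measure (measurable_disagree mgX mhX).
have finE (m : probability (T * bool * bool)%type R) : Err m h \is a fin_num.
  exact: fin_num_measure (measurable_disagree measurable_labelY mhX).
have Err_le m : `|Err m h - D m| <= Err m g.
  exact: disagree_dist measurable_labelY mgX mhX.
(* The path is [Err nu h], [D nu], [D nu'], [Err nu' h]: the outer legs cost the errors of [g], the
   middle one costs [d_TV]. *)
apply: (le_trans (lee_abse_dist (finE nu) (finD nu) (finE nu'))).
rewrite -addeA; apply: leeD => //.
apply: (le_trans (lee_abse_dist (finD nu) (finD nu') (finE nu'))).
rewrite addeC; apply: leeD; first by rewrite abse_distC.
exact: disagree_d_TV.
Qed.

Lemma Err_gap (nu nu' : probability (T * bool * bool)%type R)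
    (eta : T * bool -> R) (h : T -> bool) :
  measurable_fun [set: T * bool] eta -> measurable_fun [set: T] h ->
  `|Err nu h - Err nu' h| <=
    (Err nu (bayes eta false) + Err nu' (bayes eta true))
    + d_TV (marginalX nu) (marginalX nu')
    + Order.min (bayes_disagreement nu eta) (bayes_disagreement nu' eta).
Proof.
move=> meta mh.
have mb a := measurable_bayes a meta.
have mbX a := measurable_on_featX (mb a).
have bdE m : bayes_disagreement m eta =
    m [set w | bayes eta false (featX w) <> bayes eta true (featX w)].
  exact: expectation_disagree.
have Err_bayes_le (m : probability (T * bool * bool)%type R)
    a b : Err m (bayes eta b) <= Err m (bayes eta a) +
    m [set w | bayes eta a (featX w) <> bayes eta b (featX w)].
  exact: disagree_trans measurable_labelY (mbX a) (mbX b).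
have d_TVE (x y z t : \bar R) : x + y + z + t = x + y + t + z.
  by rewrite -addeA (addeC z) addeA.
rewrite !bdE d_TVE minEle; case: ifP => _.
(* The minimum is the [nu] term: the classifier of group [true] is the pivot, so only its error
   under [nu] has to be traded for that of the other. *)
- apply: (le_trans (Err_dist _ _ (mb true) mh)); apply: leeD => //.
  by rewrite addeAC; apply: leeD => //; exact: Err_bayes_le.
(* The minimum is the [nu'] term: the pivot is now the classifier of group [false], and the trade
   takes place under [nu']. *)
- apply: (le_trans (Err_dist _ _ (mb false) mh)); apply: leeD => //.
  rewrite -addeA; apply: leeD => //.
  rewrite (_ : [set w | _] = [set w | bayes eta true (featX w)
    <> bayes eta false (featX w)]); first exact: Err_bayes_le.
  by apply/seteqP; split=> w; exact: nesym.
Qed.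

End Classification.

Unset Implicit Arguments.
Set Strict Implicit.

Theorem theorem20 (R : realType) (d : nat) (S : set (d.-tuple R)) (x0 : S)
    (mu : probability (subspace_of x0 * bool * bool)%type R)
    (muA_gt0 : forall a : bool, 0 < mu [set w | attrA w = a])
    (eta : subspace_of x0 * bool -> R)
    (eta_version : regression_version mu eta)
    (h : subspace_of x0 -> bool)
    (mh : measurable_fun [set: subspace_of x0] h) :
  `|Err (group mu false) h - Err (group mu true) h| <=
    (noise mu eta false + noise mu eta true)
    + d_TV (marginalX (group mu false)) (marginalX (group mu true))
    + Order.min (bayes_disagreement (group mu false) eta)
                (bayes_disagreement (group mu true) eta).
Proof.
(* [noise] unfolds to the [Err] of a Bayes classifier under its own group, so this is [Err_gap] at
   the two conditional laws. *)
by have [meta _ _] := eta_version; exact: Err_gap.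
Qed.
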